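(* Let $j,k\in\mathbb{Z}_{>0}$. Then $$\sum_{n=0}^{\infty}\frac{4^n}{(2n+1)^{k+1}\binom{2n}{n}}\sum_{n\ge n_1\ge\cdots\ge n_j\ge 0}\frac{\binom{2n_j}{n_j}}{(2n_j+1)4^{n_j}}\prod_{i=1}^{j-1}\frac{1}{(2n_i+1)^2}=\frac{2}{(k-1)!}\int_0^1\frac{\ln^{k-1}\!\left(\frac{1+t^2}{2t}\right)\chi_{2j}(t)}{t}\,dt,$$ where the inner sum is over integers $n_1,\dots,n_j$ (and the empty product for $j=1$ equals $1$).
   Context: The Legendre chi function is $\chi_s(x):=\sum_{n=1}^{\infty}\frac{x^{2n-1}}{(2n-1)^s}$ for $|x|<1$, $s\in\mathbb{C}$ (also for $x=\pm1$ if $\Re(s)>1$). $\ln^{k-1}(\cdot)$ denotes the $(k-1)$-th power of the natural logarithm. *)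

(* Defs.v *)
From Stdlib Require Import Reals List Sorted Lia FinFun.
From Coquelicot Require Import Coquelicot.
Import ListNotations.
Open Scope R_scope.

(* Legendre chi function at a natural exponent [s] and real [x]; the summation
   index is shifted by one, so that 2n-1 (n >= 1) becomes 2n+1 (n >= 0). *)
Definition legendre_chi (s : nat) (x : R) : R :=
  Series (fun n : nat => x ^ (2 * n + 1) / (2 * INR n + 1) ^ s).

(* The lists [n_1; ...; n_j] with n >= n_1 >= ... >= n_j >= 0, each occurring
   exactly once; see [in_chains] and [NoDup_chains]. *)
Fixpoint chains (j n : nat) : list (list nat) :=
  match j with
  | O => [[]]
  | S j' => flat_map (fun m => map (cons m) (chains j' m)) (seq 0 (S n))
  end.

Lemma in_chains (j n : nat) (ns : list nat) :
  In ns (chains j n) <-> length ns = j /\ Sorted ge (n :: ns).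
Proof.
revert n ns; induction j as [|j IH]; intros n ns.
- simpl; split.
  + intros [<- | []]; split; [reflexivity | repeat constructor].
  + intros [H _]; destruct ns; [now left | discriminate].
- cbn [chains]; rewrite in_flat_map; split.
  + intros [m [Hm Hns]].
    apply in_map_iff in Hns; destruct Hns as [l [<- Hl]].
    apply IH in Hl; destruct Hl as [Hlen Hs]; apply in_seq in Hm.
    split; [simpl; now rewrite Hlen |].
    constructor; [exact Hs | constructor; lia].
  + intros [Hlen Hs]; destruct ns as [|m l]; [discriminate |].
    apply Sorted_inv in Hs; destruct Hs as [Hs Hd]; inversion Hd; subst.
    exists m; split; [apply in_seq; lia |].
    apply in_map, IH; split; [now injection Hlen | exact Hs].
Qed.

Lemma NoDup_chains (j n : nat) : NoDup (chains j n).
Proof.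
revert n; induction j as [|j IH]; intros n.
- repeat constructor; simpl; tauto.
- cbn [chains]; generalize (seq_NoDup (S n) 0); generalize (seq 0 (S n)).
  intros l; induction l as [|m l IHl]; intros Hl; [constructor |].
  inversion Hl as [|? ? Hm Hl']; subst; cbn [flat_map].
  apply NoDup_app.
  + apply FinFun.Injective_map_NoDup; [intros a b Hab; now injection Hab | apply IH].
  + now apply IHl.
  + intros a Ha Hb; apply in_map_iff in Ha; destruct Ha as [a' [<- _]].
    apply in_flat_map in Hb; destruct Hb as [m' [Hm' Hb]].
    apply in_map_iff in Hb; destruct Hb as [b' [Hb _]].
    injection Hb as -> _; contradiction.
Qed.

Definition sum_list (l : list R) : R := fold_right Rplus 0 l.
Definition prod_list (l : list R) : R := fold_right Rmult 1 l.

(* The summand for ns = [n_1; ...; n_j] with j >= 1: [last ns 0] is n_j and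
   [removelast ns] is [n_1; ...; n_(j-1)]. *)
Definition inner_term (ns : list nat) : R :=
  let nj := last ns 0%nat in
  Binomial.C (2 * nj) nj / ((2 * INR nj + 1) * 4 ^ nj)
  * prod_list (map (fun ni => 1 / (2 * INR ni + 1) ^ 2) (removelast ns)).

Definition inner_sum (j n : nat) : R :=
  sum_list (map inner_term (chains j n)).

Definition outer_term (j k n : nat) : R :=
  4 ^ n / ((2 * INR n + 1) ^ (k + 1) * Binomial.C (2 * n) n) * inner_sum j n.

Definition integrand (j k : nat) (t : R) : R :=
  ln ((1 + t ^ 2) / (2 * t)) ^ (k - 1) * legendre_chi (2 * j) t / t.

(* Main.v *)
(* Write [a_n = 2n + 1], [c_n = binom(2n, n) / 4^n], let [S_j n] be the inner sum
   and [G_j x = sum_n S_j n / (c_n a_n) x^(a_n)]. With [x = 2t / (1 + t^2)], i.e.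
   [x = sin theta] and [t = tan (theta / 2)], one has
     cos theta * G_j (sin theta) = 2 chi_(2j) (t),
   by induction on [j]: the operator [t d/dt = sin theta d/dtheta], applied
   twice, lowers [j] by one on both sides, which for [G_j] amounts to
   [c_(n+1) = c_n a_n / (a_n + 1)] and [S_(j+1) n - S_(j+1) (n-1) = S_j n / a_n^2].
   The sum over [n] is then the integral of
     (2 / (k-1)!) ln^(k-1) ((1 + t^2) / (2t)) chi_(2j) (t) / t
   because [int_0^1 x^(2n) (- ln x)^(k-1) dx / (k-1)! = 1 / a_n^k]; all terms are
   nonnegative, so sum and integral are exchanged by comparing the partial sums
   with the integrals over compact subintervals of [(0, 1)]. *)
Require Import Defs.
From Stdlib Require Import Arith Factorial Reals.
From Coquelicot Require Import Coquelicot.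
From Stdlib Require Import Lra Lia List.
Open Scope R_scope.

(** * Power series in the square of the variable *)

Definition oddR (n : nat) : R := 2 * INR n + 1.

Lemma oddR_ge_1 (n : nat) : 1 <= oddR n.
Proof. unfold oddR; pose proof (pos_INR n); lra. Qed.

Lemma oddR_S (n : nat) : oddR (S n) = oddR n + 2.
Proof. unfold oddR; rewrite S_INR; ring. Qed.

Lemma oddR_INR (n : nat) : oddR n = INR (2 * n + 1).
Proof. unfold oddR; rewrite plus_INR, mult_INR; simpl; ring. Qed.

(** Comparison with the second derivative of the geometric series, which keeps the radius of
    convergence: its coefficients (n+1)(n+2) satisfy (2n+1)^2 <= 4 (n+1)(n+2). The midpoint [r]
    between |x| and 1 makes the inequality strict. *)
Lemma CV_radius_gt_of_quadratic_bound (u : nat -> R) (x : R) :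
  (forall n, Rabs (u n) <= oddR n ^ 2) -> Rabs x < 1 ->
  Rbar_lt (Rabs x) (CV_radius u).
Proof.
intros Hu Hx.
set (r := (Rabs x + 1) / 2).
assert (Hr : 0 < r < 1) by (unfold r; pose proof (Rabs_pos x); lra).
assert (Hxr : Rabs x < r) by (unfold r; lra).
set (b := PS_derive (PS_derive (fun _ : nat => 1))).
assert (Hb : Rbar_lt (Rabs r) (CV_radius b)).
{ unfold b; rewrite !CV_radius_derive.
  apply Rbar_lt_le_trans with 1.
  - simpl; rewrite Rabs_pos_eq; lra.
  - apply (proj1 (CV_radius_bounded _)).
    exists 1; intros n; rewrite pow1, Rmult_1_l, Rabs_R1; lra. }
apply CV_disk_inside in Hb.
apply Rbar_lt_le_trans with r; [exact Hxr |].
apply (proj1 (Lub_Rbar_correct (CV_disk u))); unfold CV_disk.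
apply (ex_series_le (K := R_AbsRing) (V := R_CompleteNormedModule) _
  (fun n => 4 * Rabs (b n * r ^ n))).
- intros n; unfold norm; simpl; unfold abs; simpl.
  rewrite Rabs_Rabsolu, !Rabs_mult, <- Rmult_assoc.
  apply Rmult_le_compat_r; [apply Rabs_pos |].
  eapply Rle_trans; [apply Hu |].
  unfold b, PS_derive; rewrite Rabs_pos_eq.
  + unfold oddR; rewrite !S_INR; pose proof (pos_INR n); nra.
  + rewrite !S_INR; pose proof (pos_INR n); nra.
- now apply (ex_series_scal_l (K := R_AbsRing) (V := R_NormedModule) 4).
Qed.

(** The odd series sum_n u_n x^(a_n) is [x * even_series u x]; keeping the factor x apart leaves an
    ordinary power series in x^2. *)
Definition even_series (u : nat -> R) (x : R) : R := PSeries u (x ^ 2).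

Lemma Rabs_sqr_lt_1 (x : R) : Rabs x < 1 -> Rabs (x ^ 2) < 1.
Proof.
intros H; rewrite <- RPow_abs; pose proof (Rabs_pos x); simpl; nra.
Qed.

Lemma even_series_0 (u : nat -> R) : even_series u 0 = u 0%nat.
Proof.
unfold even_series; replace (0 ^ 2) with 0 by ring; apply PSeries_0.
Qed.

Lemma ex_pseries_of_quadratic_bound (u : nat -> R) (x : R) :
  (forall n, Rabs (u n) <= oddR n ^ 2) -> Rabs x < 1 -> ex_pseries u x.
Proof.
intros Hu Hx; now apply CV_radius_inside, CV_radius_gt_of_quadratic_bound.
Qed.

Lemma is_derive_odd_series (u : nat -> R) (x : R) :
  (forall n, Rabs (oddR n * u n) <= oddR n ^ 2) -> Rabs x < 1 ->
  is_derive (fun y => y * even_series u y) x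
    (even_series (fun n => oddR n * u n) x).
Proof.
intros Hu Hx; apply Rabs_sqr_lt_1 in Hx.
assert (Hu' : forall n, Rabs (u n) <= oddR n ^ 2).
{ intros n; specialize (Hu n); rewrite Rabs_mult in Hu.
  pose proof (oddR_ge_1 n); rewrite (Rabs_pos_eq (oddR n)) in Hu by lra.
  pose proof (Rabs_pos (u n)); nra. }
assert (Hr := CV_radius_gt_of_quadratic_bound u _ Hu' Hx).
assert (Hd := is_derive_PSeries u _ Hr).
assert (Hd' : is_derive (even_series u) x
                (2 * x * PSeries (PS_derive u) (x ^ 2))).
{ unfold even_series.
  refine (is_derive_comp (PSeries u) (fun y => y ^ 2) x _ (2 * x) Hd _).
  auto_derive; [trivial | ring]. }
assert (Hid : is_derive (fun y : R => y) x 1) by (apply (is_derive_id x)).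
evar_last.
- apply (is_derive_mult (fun y => y) (even_series u) x 1 _ Hid Hd').
  intros; apply Rmult_comm.
- unfold even_series, plus, mult; simpl.
  assert (Hex : ex_pseries (PS_derive u) (x ^ 2)).
  { apply CV_radius_inside; now rewrite CV_radius_derive. }
  (* With z = x^2 and U(z) the series of [u], the product rule gives 2 z U'(z) + U(z), whose n-th
     coefficient is (2n + 1) u_n. *)
  replace (1 * PSeries u (x * (x * 1)) +
     x * (2 * x * PSeries (PS_derive u) (x * (x * 1))))
   with (2 * (x ^ 2 * PSeries (PS_derive u) (x ^ 2)) + PSeries u (x ^ 2))
   by (simpl; ring).
  change (x * (x * 1)) with (x ^ 2).
  rewrite <- PSeries_incr_1, <- PSeries_scal, <- PSeries_plus.
  + apply PSeries_ext; intros [|n]; unfold PS_plus, PS_scal, PS_incr_1, PS_derive, oddR, plus, scal; simpl.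
    * unfold mult, zero; simpl; ring.
    * unfold mult; simpl; ring.
  + apply ex_pseries_scal; [apply Rmult_comm |]; now apply ex_pseries_incr_1.
  + now apply ex_pseries_of_quadratic_bound.
Qed.

Lemma continuous_even_series (u : nat -> R) (x : R) :
  (forall n, Rabs (u n) <= oddR n ^ 2) -> Rabs x < 1 ->
  continuous (even_series u) x.
Proof.
intros Hu Hx; apply Rabs_sqr_lt_1 in Hx.
apply (continuous_comp (fun y => y ^ 2) (PSeries u)).
- apply (ex_derive_continuous (fun y : R => y ^ 2)); auto_derive; trivial.
- apply continuity_pt_filterlim, PSeries_continuity.
  now apply CV_radius_gt_of_quadratic_bound.
Qed.

(** * Central binomials, nested sums and the coefficients of G_j *)

Definition central (n : nat) : R := Binomial.C (2 * n) n / 4 ^ n.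

Lemma central_0 : central 0 = 1.
Proof. unfold central, Binomial.C; simpl; field. Qed.

Lemma central_S (n : nat) :
  central (S n) = central n * oddR n / (oddR n + 1).
Proof.
unfold central, Binomial.C, oddR.
replace (2 * S n - S n)%nat with (S n) by lia.
replace (2 * n - n)%nat with n by lia.
replace (2 * S n)%nat with (S (S (2 * n))) by lia.
rewrite !fact_simpl, !mult_INR, !S_INR, mult_INR.
pose proof (INR_fact_neq_0 n); pose proof (pos_INR n).
pose proof (pow_nonzero 4 n).
simpl (4 ^ S n); simpl (INR 2); field.
repeat split; try lra; apply H1; lra.
Qed.

(** From n to n+1, c_n is multiplied by a_n / (a_n + 1) <= 1, whereas c_n a_n is multiplied by 1 + 1
    / (a_n + 1). The lower bound on c_n a_n controls the denominator of [outer_coeff]. *)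
Lemma central_bounds (n : nat) : 1 <= central n * oddR n /\ 0 < central n <= 1.
Proof.
induction n as [|n [H1 H2]].
- rewrite central_0; unfold oddR; simpl; lra.
- pose proof (oddR_ge_1 n); rewrite central_S, oddR_S.
  assert (Hq : 0 < oddR n / (oddR n + 1) <= 1).
  { split; [apply Rdiv_lt_0_compat; lra |].
    apply Rmult_le_reg_r with (oddR n + 1); [lra |]; field_simplify; lra. }
  replace (central n * oddR n / (oddR n + 1))
    with (central n * (oddR n / (oddR n + 1))) by (field; lra).
  split; [| split; nra].
  replace (central n * (oddR n / (oddR n + 1)) * (oddR n + 2))
    with (central n * oddR n * (1 + / (oddR n + 1))) by (field; lra).
  assert (0 < / (oddR n + 1)) by (apply Rinv_0_lt_compat; lra).
  nra.
Qed.

(* For [j >= 1] this is [inner_sum j]; the value at [j = 0] is chosen so that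
   the recursion also produces [inner_sum 1]. *)
Fixpoint chain_sum (j n : nat) : R :=
  match j with
  | O => oddR n * central n
  | S j' => sum_f_R0 (fun m => chain_sum j' m / oddR m ^ 2) n
  end.

(** A bound by a_m at level j makes each summand of the next level at most 1, and n + 1 such
    summands add up to at most a_n. *)
Lemma chain_sum_bounds (j n : nat) : 0 <= chain_sum j n <= oddR n.
Proof.
revert n; induction j as [|j IH]; intros n; simpl.
- pose proof (oddR_ge_1 n); destruct (central_bounds n); nra.
- assert (H : forall m, 0 <= chain_sum j m / (oddR m * (oddR m * 1)) <= 1).
  { intros m; pose proof (oddR_ge_1 m); specialize (IH m).
    assert (Hp : 0 < oddR m * (oddR m * 1)) by nra.
    split; [apply Rdiv_le_0_compat; lra |].
    apply Rmult_le_reg_r with (oddR m * (oddR m * 1)); [exact Hp |].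
    unfold Rdiv; rewrite Rmult_assoc, Rinv_l by lra; nra. }
  induction n as [|n IHn].
  + specialize (H 0%nat); pose proof (oddR_ge_1 0); cbn [sum_f_R0]; lra.
  + rewrite oddR_S; specialize (H (S n)); cbn [sum_f_R0]; lra.
Qed.

Lemma chain_sum_0 (j : nat) : chain_sum j 0 = 1.
Proof.
induction j as [|j IH]; simpl.
- rewrite central_0; unfold oddR; simpl; lra.
- rewrite IH; unfold oddR; simpl; field.
Qed.

(** The coefficient of x^(a_n) in G_j. At j = 0 it is constantly 1, so that G_0 is x / (1 - x^2). *)
Definition outer_coeff (j n : nat) : R := chain_sum j n / (central n * oddR n).

Lemma outer_coeff_bounds (j n : nat) : 0 <= outer_coeff j n <= oddR n.
Proof.
unfold outer_coeff; destruct (central_bounds n); pose proof (chain_sum_bounds j n).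
split; [apply Rdiv_le_0_compat; lra |].
apply Rmult_le_reg_r with (central n * oddR n); [lra |].
unfold Rdiv; rewrite Rmult_assoc, Rinv_l by lra; nra.
Qed.

Lemma outer_coeff_abs_le (j n : nat) :
  Rabs (outer_coeff j n) <= oddR n ^ 2 /\
  Rabs (oddR n * outer_coeff j n) <= oddR n ^ 2.
Proof.
pose proof (outer_coeff_bounds j n); pose proof (oddR_ge_1 n).
rewrite !Rabs_pos_eq by nra; nra.
Qed.

(** Since (a_n + 1) / (c_n a_n) = 1 / c_(n+1), both products on the left have denominator c_(n+1),
    and their difference isolates the last term of the nested sum. *)
Lemma outer_coeff_rec (j n : nat) :
  oddR (S n) * outer_coeff (S j) (S n) - (oddR n + 1) * outer_coeff (S j) n
  = outer_coeff j (S n) / oddR (S n).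
Proof.
unfold outer_coeff; cbn [chain_sum sum_f_R0]; rewrite central_S.
destruct (central_bounds n); pose proof (oddR_ge_1 n); pose proof (oddR_ge_1 (S n)).
field; repeat split; lra.
Qed.

(** With G = G_(j+1) and x = sin theta, the left side is (1 - x^2) G' - x G, the derivative of cos
    theta * G (sin theta) in theta. The coefficients are compared by [outer_coeff_rec]; both
    constant terms are 1. *)
Lemma even_series_outer_coeff_rec (j : nat) (x : R) : Rabs x < 1 ->
  (1 - x ^ 2) * even_series (fun n => oddR n * outer_coeff (S j) n) x
  - x ^ 2 * even_series (outer_coeff (S j)) x
  = even_series (fun n => outer_coeff j n / oddR n) x.
Proof.
intros Hx; apply Rabs_sqr_lt_1 in Hx; unfold even_series.
assert (H1 : ex_pseries (fun n => oddR n * outer_coeff (S j) n) (x ^ 2))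
  by (apply ex_pseries_of_quadratic_bound; [intros; apply outer_coeff_abs_le | easy]).
assert (H2 : ex_pseries (outer_coeff (S j)) (x ^ 2))
  by (apply ex_pseries_of_quadratic_bound; [intros; apply outer_coeff_abs_le | easy]).
(* In the form a - z (a + b), the shifted series has the coefficients a_n g_n + g_n = (a_n + 1) g_n
   of the recurrence. *)
match goal with |- (1 - ?z) * ?a - _ * ?b = _ =>
  replace ((1 - z) * a - z * b) with (a - z * (a + b)) by ring end.
rewrite <- PSeries_plus by assumption.
rewrite <- PSeries_incr_1, <- PSeries_minus.
- apply PSeries_ext; intros [|n]; unfold PS_minus, PS_plus, PS_opp, PS_incr_1, plus, opp, zero; simpl.
  + unfold outer_coeff; rewrite !chain_sum_0, central_0; unfold oddR; simpl; field.
  + rewrite <- outer_coeff_rec; ring.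
- assumption.
- apply ex_pseries_incr_1; now apply ex_pseries_plus.
Qed.

(** * The nested sum over lists as an iterated finite sum *)

Lemma sum_list_app (l l' : list R) :
  sum_list (l ++ l') = sum_list l + sum_list l'.
Proof. induction l as [|a l IH]; simpl; [ring |]; rewrite IH; ring. Qed.

Lemma sum_list_flat_map_seq (f : nat -> list R) (n : nat) :
  sum_list (flat_map f (seq 0 (S n))) = sum_f_R0 (fun m => sum_list (f m)) n.
Proof.
induction n as [|n IH].
- simpl; now rewrite app_nil_r.
- rewrite seq_S, flat_map_app, sum_list_app, IH; simpl.
  now rewrite app_nil_r.
Qed.

Lemma map_flat_map {A B C : Type} (g : B -> C) (f : A -> list B) (l : list A) :
  map g (flat_map f l) = flat_map (fun x => map g (f x)) l.
Proof. induction l as [|a l IH]; simpl; [easy |]; now rewrite map_app, IH. Qed.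

Lemma sum_list_map_div {A : Type} (f : A -> R) (c : R) (l : list A) :
  sum_list (map (fun x => f x / c) l) = sum_list (map f l) / c.
Proof.
induction l as [|a l IH]; simpl; [unfold Rdiv; ring |].
rewrite IH; unfold Rdiv; ring.
Qed.

Lemma inner_term_cons (m : nat) (ns : list nat) :
  ns <> nil -> inner_term (m :: ns) = inner_term ns / oddR m ^ 2.
Proof.
intros Hns; destruct ns as [|p ns]; [easy |]; unfold inner_term.
change (last (m :: p :: ns) 0%nat) with (last (p :: ns) 0%nat).
change (removelast (m :: p :: ns)) with (m :: removelast (p :: ns)).
cbn [map prod_list fold_right]; fold (oddR m); unfold prod_list, Rdiv; ring.
Qed.

(** Splitting off the outermost index m divides the remaining term by a_m^2. When m is the only
    index, its term is c_m / a_m = (a_m c_m) / a_m^2, which matches [chain_sum 0]. *)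
Lemma inner_sum_chain_sum (j n : nat) : inner_sum (S j) n = chain_sum (S j) n.
Proof.
revert n; induction j as [|j IH]; intros n; unfold inner_sum;
  match goal with |- _ = chain_sum (S ?i) _ =>
    change (chains (S i) n)
      with (flat_map (fun m => map (cons m) (chains i m)) (seq 0 (S n)));
    change (chain_sum (S i) n)
      with (sum_f_R0 (fun m => chain_sum i m / oddR m ^ 2) n)
  end;
  rewrite map_flat_map, sum_list_flat_map_seq; apply sum_eq; intros m _.
- cbn [chains map sum_list fold_right chain_sum].
  unfold inner_term, central, oddR; cbn [last removelast map prod_list fold_right].
  pose proof (pos_INR m); pose proof (pow_nonzero 4 m ltac:(lra)).
  field; split; lra.
- rewrite <- IH; unfold inner_sum; rewrite map_map.
  rewrite <- sum_list_map_div; f_equal; apply map_ext_in; intros ns Hns.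
  apply inner_term_cons; apply in_chains in Hns.
  destruct Hns as [Hlen _]; now destruct ns.
Qed.

(** One factor a_n of the denominator is absorbed into [outer_coeff]; the remaining power is the
    logarithmic moment [log_primitive_1]. *)
Lemma outer_term_eq (j k n : nat) :
  outer_term (S j) (S k) n = outer_coeff (S j) n / oddR n ^ S k.
Proof.
unfold outer_term; rewrite inner_sum_chain_sum; fold (oddR n).
unfold outer_coeff.
replace (4 ^ n / (oddR n ^ (S k + 1) * Binomial.C (2 * n) n))
  with (/ (oddR n ^ S k * oddR n * central n)).
- destruct (central_bounds n); pose proof (oddR_ge_1 n).
  pose proof (pow_nonzero (oddR n) (S k)); field; repeat split; lra.
- destruct (central_bounds n); pose proof (oddR_ge_1 n).
  assert (H2 : Binomial.C (2 * n) n = central n * 4 ^ n)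
    by (unfold central; field; apply pow_nonzero; lra).
  rewrite H2, pow_add, pow_1; pose proof (pow_nonzero (oddR n) (S k)).
  pose proof (pow_nonzero 4 n); field; repeat split; lra.
Qed.

(** * The chi function as a power series, and the half-angle substitution *)

Lemma legendre_chi_even_series (s : nat) (t : R) :
  legendre_chi s t = t * even_series (fun n => / oddR n ^ s) t.
Proof.
unfold legendre_chi, even_series, PSeries; rewrite <- Series_scal_l.
apply Series_ext; intros n; fold (oddR n).
rewrite Nat.add_1_r, <- tech_pow_Rmult, pow_mult; unfold Rdiv; ring.
Qed.

Lemma inv_oddR_pow_bounds (s n : nat) : 0 < / oddR n ^ s <= 1.
Proof.
pose proof (oddR_ge_1 n); split.
- apply Rinv_0_lt_compat, pow_lt; lra.
- rewrite <- Rinv_1; apply Rinv_le_contravar; [lra | apply pow_R1_Rle; lra].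
Qed.

Lemma inv_oddR_pow_abs_le (s n : nat) :
  Rabs (/ oddR n ^ s) <= oddR n ^ 2 /\
  Rabs (oddR n * / oddR n ^ s) <= oddR n ^ 2.
Proof.
destruct (inv_oddR_pow_bounds s n); pose proof (oddR_ge_1 n).
rewrite !Rabs_pos_eq by nra; nra.
Qed.

Lemma oddR_inv_oddR_pow_S (s n : nat) : oddR n * / oddR n ^ S s = / oddR n ^ s.
Proof.
pose proof (oddR_ge_1 n); simpl.
pose proof (pow_nonzero (oddR n) s ltac:(lra)); field; split; lra.
Qed.

(* The substitution [x = sin theta], [t = tan (theta / 2)]. *)
Definition half_angle_sin (t : R) : R := 2 * t / (1 + t ^ 2).

Lemma one_plus_sqr_pos (t : R) : 0 < 1 + t ^ 2.
Proof. nra. Qed.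

Lemma half_angle_sin_bounds (t : R) : 0 < t < 1 -> 0 < half_angle_sin t < 1.
Proof.
intros Ht; unfold half_angle_sin; pose proof (one_plus_sqr_pos t); split.
- apply Rdiv_lt_0_compat; lra.
- apply Rmult_lt_reg_r with (1 + t ^ 2); [lra |].
  unfold Rdiv; rewrite Rmult_assoc, Rinv_l by lra; nra.
Qed.

Lemma half_angle_sin_0 : half_angle_sin 0 = 0.
Proof. unfold half_angle_sin; field; lra. Qed.

Lemma half_angle_sin_1 : half_angle_sin 1 = 1.
Proof. unfold half_angle_sin; field; lra. Qed.

Lemma half_angle_sin_abs (t : R) : 0 <= t < 1 -> Rabs (half_angle_sin t) < 1.
Proof.
intros [[Ht | <-] Ht1].
- destruct (half_angle_sin_bounds t (conj Ht Ht1)); rewrite Rabs_pos_eq; lra.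
- rewrite half_angle_sin_0, Rabs_R0; lra.
Qed.

(** This is dx/dt; as cos theta = (1 - t^2) / (1 + t^2), it equals cos theta * x / t for t > 0. *)
Definition half_angle_sin' (t : R) : R := 2 * (1 - t ^ 2) / (1 + t ^ 2) ^ 2.

Lemma is_derive_half_angle_sin (t : R) :
  is_derive half_angle_sin t (half_angle_sin' t).
Proof.
pose proof (one_plus_sqr_pos t); unfold half_angle_sin, half_angle_sin'.
auto_derive; [simpl in *; lra |]; simpl in *; field; apply Rgt_not_eq; nra.
Qed.

(** * The identity between G_j and chi_(2j) *)

Lemma eq_of_is_derive (f1 f2 df : R -> R) (b : R) :
  f1 0 = f2 0 -> 0 <= b ->
  (forall t, 0 <= t <= b -> is_derive f1 t (df t)) ->
  (forall t, 0 <= t <= b -> is_derive f2 t (df t)) -> f1 b = f2 b.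
Proof.
intros H0 [Hb | <-] H1 H2; [| exact H0].
enough (f1 0 - f2 0 = f1 b - f2 b) by lra.
apply (eq_is_derive (fun t => f1 t - f2 t)); [| exact Hb].
intros t Ht; evar_last.
- apply (is_derive_minus f1 f2 t (df t) (df t)); auto.
- apply (minus_eq_zero (G := R_AbelianGroup)).
Qed.

(** The first of the two integrations in the induction. Multiplied by x, the conclusion reads sum_n
    g_n / a_n x^(a_n) = 2 chi_(2j+1) (t) with g = [outer_coeff j]; both sides vanish at 0, and their
    derivatives in t agree by the hypothesis. *)
Lemma even_series_half_angle_odd (j : nat) :
  (forall t, 0 <= t < 1 -> half_angle_sin' t * even_series (outer_coeff j) (half_angle_sin t)
     = 2 * even_series (fun n => / oddR n ^ (2 * j)) t) ->
  forall t, 0 <= t < 1 ->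
  even_series (fun n => outer_coeff j n / oddR n) (half_angle_sin t)
  = (1 + t ^ 2) * even_series (fun n => / oddR n ^ S (2 * j)) t.
Proof.
intros IH t [[Ht0 | <-] Ht1].
- apply Rmult_eq_reg_l with (half_angle_sin t);
    [| apply Rgt_not_eq, half_angle_sin_bounds; lra].
  replace (half_angle_sin t * ((1 + t ^ 2) * even_series (fun n => / oddR n ^ S (2 * j)) t))
    with (2 * (t * even_series (fun n => / oddR n ^ S (2 * j)) t))
    by (unfold half_angle_sin; field; apply Rgt_not_eq, one_plus_sqr_pos).
  apply (eq_of_is_derive
    (fun s => half_angle_sin s * even_series (fun n => outer_coeff j n / oddR n) (half_angle_sin s))
    (fun s => 2 * (s * even_series (fun n => / oddR n ^ S (2 * j)) s))
    (fun s => half_angle_sin' s * even_series (outer_coeff j) (half_angle_sin s))).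
  + rewrite half_angle_sin_0; ring.
  + lra.
  + intros s Hs.
    apply (is_derive_comp (fun x => x * even_series (fun n => outer_coeff j n / oddR n) x)).
    * evar_last; [apply is_derive_odd_series |].
      -- intros n; replace (oddR n * (outer_coeff j n / oddR n)) with (outer_coeff j n).
         ++ apply outer_coeff_abs_le.
         ++ pose proof (oddR_ge_1 n); field; lra.
      -- apply half_angle_sin_abs; lra.
      -- apply Series_ext; intros n; pose proof (oddR_ge_1 n); f_equal; field; lra.
    * apply is_derive_half_angle_sin.
  + intros s Hs; rewrite IH by lra.
    apply is_derive_scal; evar_last; [apply is_derive_odd_series |].
    * intros n; apply inv_oddR_pow_abs_le.
    * rewrite Rabs_pos_eq; lra.
    * apply Series_ext; intros n; now rewrite oddR_inv_oddR_pow_S.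
(* At t = 0 the factor x cannot be cancelled, but only the constant coefficients remain, both equal
   to 1. *)
- rewrite half_angle_sin_0, !even_series_0.
  unfold outer_coeff; rewrite chain_sum_0, central_0.
  replace (oddR 0) with 1 by (unfold oddR; simpl; ring).
  rewrite pow1; field.
Qed.

(** The identity cos theta * G_j (sin theta) = 2 chi_(2j) (t) divided by t, a form that covers t =
    0. For j = 0 both series are geometric and 1 - x^2 = ((1 - t^2) / (1 + t^2))^2; the induction
    step is the second integration. *)
Lemma even_series_half_angle (j : nat) (t : R) : 0 <= t < 1 ->
  half_angle_sin' t * even_series (outer_coeff j) (half_angle_sin t)
  = 2 * even_series (fun n => / oddR n ^ (2 * j)) t.
Proof.
revert t; induction j as [|j IH].
- intros t Ht.
  assert (Hgeo : forall (u : nat -> R) x, (forall n, u n = 1) -> Rabs x < 1 ->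
             even_series u x = / (1 - x ^ 2)).
  { intros u x Hu Hx; unfold even_series, PSeries; rewrite <- Series_geom by now apply Rabs_sqr_lt_1.
    apply Series_ext; intros n; now rewrite Hu, Rmult_1_l. }
  rewrite !Hgeo.
  + unfold half_angle_sin', half_angle_sin; pose proof (one_plus_sqr_pos t).
    assert (0 < 1 - t ^ 2) by nra.
    replace (1 - (2 * t / (1 + t ^ 2)) ^ 2) with (((1 - t ^ 2) / (1 + t ^ 2)) ^ 2)
      by (field; lra).
    field; lra.
  + intros n; simpl; field.
  + rewrite Rabs_pos_eq; lra.
  + intros n; unfold outer_coeff; simpl chain_sum.
    destruct (central_bounds n); pose proof (oddR_ge_1 n); field; lra.
  + now apply half_angle_sin_abs.
- intros t [[Ht0 | <-] Ht1].
  2: { rewrite half_angle_sin_0, !even_series_0.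
       unfold outer_coeff, half_angle_sin'; rewrite chain_sum_0, central_0.
       replace (oddR 0) with 1 by (unfold oddR; simpl; ring).
       rewrite pow1; field; simpl; lra. }
  apply Rmult_eq_reg_l with t; [| lra].
  replace (t * (2 * even_series (fun n => / oddR n ^ (2 * S j)) t))
    with (2 * (t * even_series (fun n => / oddR n ^ (2 * S j)) t)) by ring.
  (* By t dx/dt = x cos theta, the left side turns into cos theta * G_(j+1) (x), which vanishes at t
     = 0. *)
  replace (t * (half_angle_sin' t * even_series (outer_coeff (S j)) (half_angle_sin t)))
    with ((1 - t ^ 2) / (1 + t ^ 2) *
           (half_angle_sin t * even_series (outer_coeff (S j)) (half_angle_sin t)))
    by (unfold half_angle_sin'; unfold half_angle_sin at 1; field; apply Rgt_not_eq, one_plus_sqr_pos).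
  apply (eq_of_is_derive
    (fun s => (1 - s ^ 2) / (1 + s ^ 2) *
           (half_angle_sin s * even_series (outer_coeff (S j)) (half_angle_sin s)))
    (fun s => 2 * (s * even_series (fun n => / oddR n ^ (2 * S j)) s))
    (fun s => 2 * even_series (fun n => / oddR n ^ S (2 * j)) s)).
  + rewrite half_angle_sin_0; ring.
  + lra.
  + intros s Hs; pose proof (one_plus_sqr_pos s).
    assert (Hx : Rabs (half_angle_sin s) < 1) by (apply half_angle_sin_abs; lra).
    assert (Hd : is_derive (fun s => half_angle_sin s * even_series (outer_coeff (S j)) (half_angle_sin s)) s
       (half_angle_sin' s * even_series (fun n => oddR n * outer_coeff (S j) n) (half_angle_sin s))).
    { apply (is_derive_comp (fun x => x * even_series (outer_coeff (S j)) x)).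
      - apply is_derive_odd_series; [intros n; apply outer_coeff_abs_le | exact Hx].
      - apply is_derive_half_angle_sin. }
    assert (Hc : is_derive (fun s => (1 - s ^ 2) / (1 + s ^ 2)) s (- 4 * s / (1 + s ^ 2) ^ 2)).
    { auto_derive; [simpl in *; lra |]; simpl in *; field; apply Rgt_not_eq; nra. }
    evar_last.
    * apply (is_derive_mult (fun s => (1 - s ^ 2) / (1 + s ^ 2)) _ s _ _ Hc Hd).
      intros; apply Rmult_comm.
    * unfold plus, mult; cbn -[pow Nat.mul].
      pose proof (even_series_outer_coeff_rec j _ Hx) as Hrec.
      rewrite (even_series_half_angle_odd j IH) in Hrec by lra.
      (* Times 1 + s^2, the product rule yields 2 ((1 - x^2) E1 - x^2 E2), twice the left side of
         [Hrec], with E1 and E2 the two series named below. *)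
      apply Rmult_eq_reg_l with (1 + s ^ 2); [| lra].
      match goal with |- _ = ?a * (2 * ?e) =>
        replace (a * (2 * e)) with (2 * (a * e)) by ring end.
      rewrite <- Hrec.
      unfold half_angle_sin'; set (E1 := even_series _ _); set (E2 := even_series _ _).
      unfold half_angle_sin; field; lra.
  + intros s Hs.
    apply is_derive_scal; evar_last; [apply is_derive_odd_series |].
    * intros n; apply inv_oddR_pow_abs_le.
    * rewrite Rabs_pos_eq; lra.
    * apply Series_ext; intros n; replace (2 * S j)%nat with (S (S (2 * j))) by lia.
      now rewrite oddR_inv_oddR_pow_S.
Qed.

(** * Logarithmic moments *)

(** Retypes an equality stated over the carrier of an algebraic structure as one over [R], where
    [ring] applies. *)
Ltac real_eq := match goal with |- @eq _ ?a ?b => change (@eq R a b) end.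

(* The primitive of [x ^ (2 n) (- ln x) ^ K / K!] that vanishes at 0. *)
Fixpoint log_primitive (K n : nat) (x : R) : R :=
  match K with
  | O => x ^ (2 * n + 1) / oddR n
  | S K' => (log_primitive K' n x
             + x ^ (2 * n + 1) * (- ln x) ^ K / INR (fact K)) / oddR n
  end.

(** Integration by parts: the derivative of (- ln x)^K / K! contributes - x^(2n) (- ln x)^(K-1) /
    (K-1)!, which cancels the derivative of the preceding primitive. *)
Lemma is_derive_log_primitive (K n : nat) (x : R) : 0 < x ->
  is_derive (log_primitive K n) x (x ^ (2 * n) * ((- ln x) ^ K / INR (fact K))).
Proof.
intros Hx; pose proof (oddR_ge_1 n).
assert (Hpow : is_derive (fun y => y ^ (2 * n + 1)) x (oddR n * x ^ (2 * n))).
{ evar_last; [apply (is_derive_pow (fun y => y) (2 * n + 1) x 1), (is_derive_id x) |].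
  rewrite oddR_INR, Nat.add_1_r, Nat.pred_succ; ring. }
induction K as [|K IH].
- cbn [log_primitive].
  apply (is_derive_ext (fun y => / oddR n * y ^ (2 * n + 1))).
  { intros y; unfold Rdiv; real_eq; ring. }
  evar_last; [apply is_derive_scal, Hpow |].
  rewrite pow_O; change (INR (fact 0)) with 1; field; lra.
- assert (Hln : is_derive (fun y => (- ln y) ^ S K) x
            (INR (S K) * (- / x) * (- ln x) ^ K)).
  { evar_last; [apply (is_derive_pow (fun y => - ln y) (S K) x (- / x)) |].
    - auto_derive; [lra | field; lra].
    - rewrite Nat.pred_succ; ring. }
  assert (Hprod := is_derive_mult _ _ x _ _ Hpow Hln Rmult_comm).
  apply (is_derive_ext (fun y => / oddR n * (log_primitive K n y
     + / INR (fact (S K)) * (y ^ (2 * n + 1) * (- ln y) ^ S K)))).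
  { intros y; cbn [log_primitive]; unfold Rdiv; real_eq; ring. }
  evar_last.
  + apply is_derive_scal, (is_derive_plus (log_primitive K n)); [exact IH |].
    apply is_derive_scal; exact Hprod.
  + change plus with Rplus; change mult with Rmult; cbv beta.
    rewrite Nat.add_1_r, <- !tech_pow_Rmult, fact_simpl, mult_INR.
    pose proof (INR_fact_neq_0 K); pose proof (not_0_INR (S K) ltac:(lia)).
    field; repeat split; lra.
Qed.

(** The logarithmic terms vanish at 1, so each level only divides by a_n. With the limit 0 at 0,
    this is the value of the moment over (0, 1). *)
Lemma log_primitive_1 (K n : nat) : log_primitive K n 1 = / oddR n ^ S K.
Proof.
pose proof (oddR_ge_1 n); induction K as [|K IH]; cbn [log_primitive].
- rewrite pow1; field; lra.
- rewrite IH, ln_1, Ropp_0, pow_i, Rmult_0_r, <- (tech_pow_Rmult _ (S K)) by lia.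
  pose proof (pow_nonzero (oddR n) (S K) ltac:(lra)).
  pose proof (INR_fact_neq_0 (S K)); field; repeat split; lra.
Qed.

Lemma neg_ln_nonneg (x : R) : 0 < x <= 1 -> 0 <= - ln x.
Proof. intros Hx; pose proof (ln_le x 1 ltac:(lra) ltac:(lra)); rewrite ln_1 in *; lra. Qed.

Lemma log_weight_nonneg (K : nat) (x : R) :
  0 < x <= 1 -> 0 <= (- ln x) ^ K / INR (fact K).
Proof.
intros Hx; apply Rdiv_le_0_compat; [apply pow_le, neg_ln_nonneg, Hx | apply INR_fact_lt_0].
Qed.

Lemma log_primitive_nonneg (K n : nat) (x : R) : 0 < x <= 1 -> 0 <= log_primitive K n x.
Proof.
intros Hx; pose proof (oddR_ge_1 n); pose proof (pow_le x (2 * n + 1) ltac:(lra)).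
induction K as [|K IH]; cbn [log_primitive]; apply Rdiv_le_0_compat; try lra.
unfold Rdiv; rewrite Rmult_assoc.
pose proof (log_weight_nonneg (S K) x Hx); unfold Rdiv in *; nra.
Qed.

Lemma log_primitive_le (K n : nat) (x y : R) :
  0 < x -> x <= y <= 1 -> log_primitive K n x <= log_primitive K n y.
Proof.
intros Hx Hy.
destruct (MVT_gen (log_primitive K n) x y
  (fun z => z ^ (2 * n) * ((- ln z) ^ K / INR (fact K)))) as [z [Hz E]].
- intros z; rewrite Rmin_left, Rmax_right by lra; intros Hz.
  apply is_derive_log_primitive; lra.
- intros z; rewrite Rmin_left, Rmax_right by lra; intros Hz.
  apply continuity_pt_filterlim, (ex_derive_continuous (log_primitive K n)).
  eexists; apply is_derive_log_primitive; lra.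
- rewrite Rmin_left, Rmax_right in Hz by lra.
  pose proof (pow_le z (2 * n) ltac:(lra)).
  pose proof (log_weight_nonneg K z ltac:(lra)).
  assert (0 <= z ^ (2 * n) * ((- ln z) ^ K / INR (fact K))) by nra.
  nra.
Qed.

Lemma pow_div_fact_le_exp (u : R) (i : nat) : 0 <= u -> u ^ i / INR (fact i) <= exp u.
Proof.
intros Hu; eapply Rle_trans; [| apply (exp_ge_taylor u i Hu)].
destruct i as [|i]; [apply Rle_refl |].
cbn [sum_f_R0].
enough (0 <= sum_f_R0 (fun k => u ^ k / INR (fact k)) i) by lra.
apply cond_pos_sum; intros k; apply Rdiv_le_0_compat; [now apply pow_le | apply INR_fact_lt_0].
Qed.

(** For u = - ln (sqrt x), u^i / i! <= exp u = 1 / sqrt x; then - ln x = 2 u accounts for 2^i, and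
    x^(2n+1) <= x leaves x / sqrt x = sqrt x. *)
Lemma log_weight_le_sqrt (i n : nat) (x : R) : 0 < x <= 1 ->
  x ^ (2 * n + 1) * (- ln x) ^ i / INR (fact i) <= 2 ^ i * sqrt x.
Proof.
intros Hx.
assert (Hs : 0 < sqrt x) by (apply sqrt_lt_R0; lra).
assert (Hss : sqrt x * sqrt x = x) by (apply sqrt_sqrt; lra).
assert (Hs1 : sqrt x <= 1) by nra.
assert (Hln : - ln x = 2 * - ln (sqrt x)).
{ rewrite <- Hss at 1; rewrite ln_mult by lra; ring. }
assert (Hxn : 0 <= x ^ (2 * n + 1) <= x).
{ rewrite Nat.add_1_r, <- tech_pow_Rmult.
  assert (0 <= x ^ (2 * n) <= 1); [| nra].
  split; [apply pow_le; lra |]; rewrite <- (pow1 (2 * n)); apply pow_incr; lra. }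
pose proof (pow_div_fact_le_exp (- ln (sqrt x)) i (neg_ln_nonneg _ (conj Hs Hs1))) as Hexp.
rewrite exp_Ropp, exp_ln in Hexp by exact Hs.
pose proof (log_weight_nonneg i (sqrt x) (conj Hs Hs1)).
rewrite Hln, Rpow_mult_distr.
set (w := (- ln (sqrt x)) ^ i / INR (fact i)) in *.
replace (x ^ (2 * n + 1) * (2 ^ i * (- ln (sqrt x)) ^ i) / INR (fact i))
  with (2 ^ i * (x ^ (2 * n + 1) * w)) by (unfold w, Rdiv; ring).
apply Rmult_le_compat_l; [apply pow_le; lra |].
apply Rle_trans with (x * / sqrt x).
- apply Rmult_le_compat; lra.
- rewrite <- Hss at 1; field_simplify; lra.
Qed.

(** Gives the limit 0 of the primitive at 0 from the right. Each level adds its 2^i to the constant,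
    as dividing by a_n >= 1 does not increase the bound. *)
Lemma log_primitive_le_sqrt (K n : nat) :
  exists C, forall x, 0 < x <= 1 -> log_primitive K n x <= C * sqrt x.
Proof.
pose proof (oddR_ge_1 n).
assert (Hdiv : forall y, 0 <= y -> y / oddR n <= y).
{ intros y Hy; apply Rmult_le_reg_r with (oddR n); [lra |].
  unfold Rdiv; rewrite Rmult_assoc, Rinv_l by lra; nra. }
induction K as [|K [C IH]].
- exists 1; intros x Hx; cbn [log_primitive].
  pose proof (log_weight_le_sqrt 0 n x Hx) as H0.
  rewrite !pow_O in H0; change (INR (fact 0)) with 1 in H0.
  eapply Rle_trans; [apply Hdiv, pow_le; lra | lra].
- exists (C + 2 ^ S K); intros x Hx; specialize (IH x Hx).
  cbn [log_primitive].
  pose proof (log_weight_le_sqrt (S K) n x Hx).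
  pose proof (log_primitive_nonneg K n x Hx).
  eapply Rle_trans; [apply Hdiv | lra].
  pose proof (log_weight_nonneg (S K) x Hx).
  pose proof (pow_le x (2 * n + 1) ltac:(lra)).
  unfold Rdiv in *; rewrite Rmult_assoc; nra.
Qed.

(** * Termwise integration over compact subintervals of (0, 1) *)

Definition log_weight (K : nat) (x : R) : R := (- ln x) ^ K / INR (fact K).

Lemma continuous_log_weight (K : nat) (x : R) : 0 < x -> continuous (log_weight K) x.
Proof.
intros Hx; apply (ex_derive_continuous (log_weight K)); unfold log_weight.
apply (ex_derive_ext (fun y => / INR (fact K) * (- ln y) ^ K)).
{ intros y; unfold Rdiv; real_eq; ring. }
auto_derive; lra.
Qed.

Lemma log_weight_antitone (K : nat) (x y : R) : 0 < x <= y -> y <= 1 -> log_weight K y <= log_weight K x.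
Proof.
intros Hx Hy; apply Rmult_le_compat_r; [left; apply Rinv_0_lt_compat, INR_fact_lt_0 |].
apply pow_incr; split; [apply neg_ln_nonneg; lra |].
apply Ropp_le_contravar, ln_le; lra.
Qed.

Section Termwise.

Variable g : nat -> R.
Hypothesis g_pos : forall n, 0 <= g n.
Hypothesis g_le : forall n, Rabs (g n) <= oddR n ^ 2.

Lemma ex_series_even_series (x : R) : Rabs x < 1 -> ex_series (fun n => g n * (x ^ 2) ^ n).
Proof.
intros Hx; apply ex_pseries_R, ex_pseries_of_quadratic_bound; [exact g_le |].
now apply Rabs_sqr_lt_1.
Qed.

(** With nonnegative coefficients the remainder is itself increasing on [0, 1), so its value at the
    right end of an interval bounds it uniformly there. *)
Lemma even_series_remainder_le (N : nat) (x y : R) : 0 <= x <= y -> y < 1 ->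
  0 <= even_series g x - sum_f_R0 (fun n => g n * (x ^ 2) ^ n) N
    <= even_series g y - sum_f_R0 (fun n => g n * (y ^ 2) ^ n) N.
Proof.
intros Hx Hy.
assert (E : forall z, 0 <= z < 1 ->
  even_series g z - sum_f_R0 (fun n => g n * (z ^ 2) ^ n) N
  = Series (fun k => g (S N + k)%nat * (z ^ 2) ^ (S N + k)) /\
  ex_series (fun k => g (S N + k)%nat * (z ^ 2) ^ (S N + k))).
{ intros z Hz.
  assert (Hex : ex_series (fun n => g n * (z ^ 2) ^ n))
    by (apply ex_series_even_series; rewrite Rabs_pos_eq; lra).
  split.
  - unfold even_series, PSeries.
    rewrite (Series_incr_n _ (S N)) by (lia || exact Hex).
    rewrite Nat.pred_succ; ring.
  - now apply (ex_series_incr_n (fun n => g n * (z ^ 2) ^ n)). }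
destruct (E x) as [-> _]; [lra |]; destruct (E y) as [-> Hex]; [lra |].
assert (Hterm : forall k, 0 <= g (S N + k)%nat * (x ^ 2) ^ (S N + k)
                 <= g (S N + k)%nat * (y ^ 2) ^ (S N + k)).
{ intros k; split.
  - apply Rmult_le_pos; [apply g_pos | apply pow_le; nra].
  - apply Rmult_le_compat_l; [apply g_pos | apply pow_incr; simpl; nra]. }
split; [| now apply Series_le].
rewrite <- (Rmult_0_l (Series (fun k => g (S N + k)%nat * (y ^ 2) ^ (S N + k)))), <- Series_scal_l.
apply Series_le.
- intros k; rewrite Rmult_0_l; split; [apply Rle_refl | apply Hterm].
- apply (ex_series_le (K := R_AbsRing) (V := R_CompleteNormedModule) _ _) with (2 := Hex).
  intros k; unfold norm; simpl; unfold abs; simpl.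
  rewrite Rabs_pos_eq; apply Hterm.
Qed.

Lemma is_RInt_partial_sum (K N : nat) (al be : R) : 0 < al <= be ->
  is_RInt (fun x => log_weight K x * sum_f_R0 (fun n => g n * (x ^ 2) ^ n) N) al be
    (sum_f_R0 (fun n => g n * (log_primitive K n be - log_primitive K n al)) N).
Proof.
intros Hab.
assert (Hterm : forall n, is_RInt (fun x => g n * (x ^ (2 * n) * log_weight K x)) al be
   (g n * (log_primitive K n be - log_primitive K n al))).
{ intros n; apply (is_RInt_scal (fun x => x ^ (2 * n) * log_weight K x)).
  apply (is_RInt_derive (log_primitive K n));
    intros x; rewrite Rmin_left, Rmax_right by lra; intros Hx.
  - apply is_derive_log_primitive; lra.
  - apply (continuous_mult (fun x => x ^ (2 * n)) (log_weight K)).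
    + apply (ex_derive_continuous (fun x : R => x ^ (2 * n))); auto_derive; trivial.
    + apply continuous_log_weight; lra. }
induction N as [|N IH]; cbn [sum_f_R0].
- apply (is_RInt_ext (fun x => g 0%nat * (x ^ (2 * 0) * log_weight K x))).
  + intros x _; simpl; real_eq; ring.
  + apply Hterm.
- apply (is_RInt_ext (fun x =>
     log_weight K x * sum_f_R0 (fun n => g n * (x ^ 2) ^ n) N
     + g (S N) * (x ^ (2 * S N) * log_weight K x))).
  + intros x _; rewrite (pow_mult x 2); real_eq; ring.
  + apply (is_RInt_plus _ _ _ _ _ _ IH (Hterm (S N))).
Qed.

(** On [al, be] the remainder is largest at [be] and the weight is largest at [al]. Hence the N-th
    partial integral misses the limit by at most (be - al) times the product of these two values,
    which tends to 0. *)
Lemma is_series_integral (K : nat) (al be : R) : 0 < al <= be -> be < 1 ->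
  is_series (fun n => g n * (log_primitive K n be - log_primitive K n al))
    (RInt (fun x => log_weight K x * even_series g x) al be).
Proof.
intros Hab Hbe.
assert (Hex : ex_RInt (fun x => log_weight K x * even_series g x) al be).
{ apply (ex_RInt_continuous (V := R_CompleteNormedModule)); intros x; rewrite Rmin_left, Rmax_right by lra; intros Hx.
  apply (continuous_mult (log_weight K) (even_series g)).
  - apply continuous_log_weight; lra.
  - apply continuous_even_series; [exact g_le | rewrite Rabs_pos_eq; lra]. }
apply (RInt_correct (V := R_CompleteNormedModule)) in Hex.
set (l := RInt _ al be) in *; change (is_RInt (fun x => log_weight K x * even_series g x) al be l) in Hex.
set (rem := fun N => even_series g be - sum_f_R0 (fun n => g n * (be ^ 2) ^ n) N).
assert (Hrem : is_lim_seq (fun N => (be - al) * (log_weight K al * rem N)) 0).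
{ replace 0 with ((be - al) * (log_weight K al * 0)) by ring.
  apply (is_lim_seq_scal_l _ _ (Finite _)), (is_lim_seq_scal_l _ _ (Finite 0)).
  unfold rem; replace 0 with (even_series g be - even_series g be) by ring.
  apply is_lim_seq_minus'; [apply is_lim_seq_const |].
  apply (is_lim_seq_ext (sum_n (fun n => g n * (be ^ 2) ^ n))).
  { intros N; apply sum_n_Reals. }
  change (is_series (fun n => g n * (be ^ 2) ^ n) (Series (fun n => g n * (be ^ 2) ^ n))).
  apply Series_correct, ex_series_even_series.
  rewrite Rabs_pos_eq; lra. }
set (u := fun n => g n * (log_primitive K n be - log_primitive K n al)).
change (is_lim_seq (sum_n u) l).
apply (is_lim_seq_ext (sum_f_R0 u)).
{ intros N; symmetry; apply sum_n_Reals. }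
set (s := sum_f_R0 _).
assert (Hle : forall N, Rabs (l - s N) <= (be - al) * (log_weight K al * rem N)).
{ intros N.
  apply (norm_RInt_le_const (V := R_NormedModule) (fun x => log_weight K x * even_series g x
            - log_weight K x * sum_f_R0 (fun n => g n * (x ^ 2) ^ n) N) al be); [lra | |].
  - intros x Hx.
    destruct (even_series_remainder_le N x be) as [H1 H2]; [lra | lra |].
    fold (rem N) in H2.
    pose proof (log_weight_nonneg K x ltac:(lra)) as H3; fold (log_weight K x) in H3.
    pose proof (log_weight_antitone K al x ltac:(lra) ltac:(lra)) as H4.
    rewrite <- Rmult_minus_distr_l; unfold norm; simpl; unfold abs; simpl.
    rewrite Rabs_pos_eq by (apply Rmult_le_pos; assumption).
    apply Rmult_le_compat; assumption.
  - apply (is_RInt_minus (V := R_NormedModule) _ _ _ _ _ _ Hex).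
    apply is_RInt_partial_sum; lra. }
apply (is_lim_seq_le_le (fun N => l - (be - al) * (log_weight K al * rem N)) _
         (fun N => l + (be - al) * (log_weight K al * rem N))).
- intros N; specialize (Hle N); apply Rabs_le_between in Hle; lra.
- evar_last; [apply is_lim_seq_minus'; [apply is_lim_seq_const | exact Hrem] |].
  f_equal; ring.
- evar_last; [apply is_lim_seq_plus'; [apply is_lim_seq_const | exact Hrem] |].
  f_equal; ring.
Qed.

End Termwise.

(** * Continuity of the chi series up to the endpoint 1 *)

(** The Weierstrass M-test: the tails of [M] bound the remainders uniformly. The bound is global, so
    the radius 1 of the ball around [x] is arbitrary. *)
Lemma continuous_Series_dominated (f : nat -> R -> R) (M : nat -> R) (x : R) :
  (forall n y, continuous (f n) y) -> (forall n y, Rabs (f n y) <= M n) ->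
  ex_series M -> continuous (fun y => Series (fun n => f n y)) x.
Proof.
intros Hc HM HexM; apply continuity_pt_filterlim.
apply (CVU_continuity (fun N y => sum_f_R0 (fun n => f n y) N) _ x (mkposreal 1 Rlt_0_1)).
- intros eps Heps.
  assert (Hlim : is_lim_seq (sum_n M) (Series M))
    by (change (is_series M (Series M)); now apply Series_correct).
  destruct (proj2 (is_lim_seq_spec _ _) Hlim (mkposreal eps Heps)) as [N0 HN0].
  exists N0; intros N y HN _; specialize (HN0 N HN); simpl in HN0.
  assert (Hex : ex_series (fun n => Rabs (f n y))).
  { apply (ex_series_le (K := R_AbsRing) (V := R_CompleteNormedModule) _ M); [| exact HexM].
    intros n; unfold norm; simpl; unfold abs; simpl; rewrite Rabs_Rabsolu; apply HM. }
  assert (HexT : ex_series (fun k => M (S N + k)%nat))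
    by now apply (ex_series_incr_n M).
  rewrite sum_n_Reals, (Series_incr_n M (S N)) in HN0 by (lia || exact HexM).
  rewrite (Series_incr_n _ (S N)) by (lia || now apply ex_series_Rabs).
  rewrite Nat.pred_succ in *.
  match goal with |- Rabs (?a + ?b - ?a') < _ =>
    replace (a + b - a') with b by ring end.
  apply Rle_lt_trans with (Series (fun k => M (S N + k)%nat)).
  + eapply Rle_trans; [apply Series_Rabs |].
    * apply (ex_series_incr_n (fun n => Rabs (f n y)) (S N)), Hex.
    * apply Series_le; [| exact HexT]; intros k; split; [apply Rabs_pos | apply HM].
  + apply Rabs_def2 in HN0; lra.
- intros N y _; apply continuity_pt_filterlim.
  induction N as [|N IH]; cbn [sum_f_R0]; [apply Hc |].
  now apply (continuous_plus (fun y => sum_f_R0 (fun n => f n y) N)).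
- unfold Boule; simpl; rewrite Rminus_diag, Rabs_R0; lra.
Qed.

(** Telescoping: 1 / (a + 2)^2 <= 1 / a - 1 / (a + 2) bounds the partial sums for exponent 2 by 2 -
    1 / a_n; higher exponents follow by comparison. *)
Lemma ex_series_inv_oddR_pow (s : nat) : ex_series (fun n => / oddR n ^ S (S s)).
Proof.
assert (Hb : forall n, sum_f_R0 (fun n => / oddR n ^ 2) n <= 2 - / oddR n).
{ induction n as [|n IH]; cbn [sum_f_R0].
  - unfold oddR; simpl; lra.
  - rewrite oddR_S; pose proof (oddR_ge_1 n).
    enough (/ (oddR n + 2) ^ 2 <= / oddR n - / (oddR n + 2)) by lra.
    replace (/ oddR n - / (oddR n + 2)) with (2 / (oddR n * (oddR n + 2))) by (field; lra).
    apply Rmult_le_reg_r with (oddR n * (oddR n + 2) ^ 2); [nra |].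
    field_simplify; nra. }
apply (ex_series_le (K := R_AbsRing) (V := R_CompleteNormedModule) _ (fun n => / oddR n ^ 2)).
- intros n; unfold norm; simpl; unfold abs; simpl.
  change (Rabs (/ oddR n ^ S (S s)) <= / oddR n ^ 2).
  rewrite Rabs_pos_eq by (left; apply inv_oddR_pow_bounds).
  pose proof (oddR_ge_1 n); apply Rinv_le_contravar; [apply pow_lt; lra |].
  apply Rle_pow; [lra | lia].
- destruct (ex_finite_lim_seq_incr (sum_n (fun n => / oddR n ^ 2)) 2) as [l Hl].
  + intros n; rewrite !sum_n_Reals; cbn [sum_f_R0].
    pose proof (inv_oddR_pow_bounds 2 (S n)); lra.
  + intros n; rewrite sum_n_Reals; specialize (Hb n).
    pose proof (inv_oddR_pow_bounds 1 n); rewrite pow_1 in *; lra.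
  + now exists l.
Qed.

(* The series of [chi] need not converge for [t > 1]; composing it with [clamp]
   gives a function continuous at 1 from both sides. *)
Definition clamp (t : R) : R := Rmax 0 (Rmin t 1).

Lemma clamp_bounds (t : R) : 0 <= clamp t <= 1.
Proof. unfold clamp, Rmax, Rmin; repeat destruct Rle_dec; lra. Qed.

Lemma clamp_id (t : R) : 0 <= t <= 1 -> clamp t = t.
Proof. intros Ht; unfold clamp; rewrite Rmin_left, Rmax_right; lra. Qed.

Lemma continuous_clamp (t : R) : continuous clamp t.
Proof.
apply continuity_pt_filterlim; intros eps Heps; exists eps; split; [exact Heps |].
intros y [_ Hy]; simpl in *; unfold R_dist in *.
eapply Rle_lt_trans; [| exact Hy].
unfold clamp, Rmax, Rmin; repeat destruct Rle_dec; unfold Rabs; repeat destruct Rcase_abs; lra.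
Qed.

Lemma half_angle_sin_mono (a b : R) : 0 < a <= b -> b <= 1 ->
  half_angle_sin a <= half_angle_sin b.
Proof.
intros Ha Hb; unfold half_angle_sin; pose proof (one_plus_sqr_pos a); pose proof (one_plus_sqr_pos b).
apply Rmult_le_reg_r with ((1 + a ^ 2) * (1 + b ^ 2)); [nra |].
replace (2 * a / (1 + a ^ 2) * ((1 + a ^ 2) * (1 + b ^ 2))) with (2 * a * (1 + b ^ 2)) by (field; lra).
replace (2 * b / (1 + b ^ 2) * ((1 + a ^ 2) * (1 + b ^ 2))) with (2 * b * (1 + a ^ 2)) by (field; lra).
(* The two cross-multiplied sides differ by 2 (b - a) (1 - a b). *)
enough (0 <= (b - a) * (1 - a * b)) by nra.
apply Rmult_le_pos; nra.
Qed.

(** * The integrand and its improper integral *)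

Section Integrand.

Variables j K : nat.

Let s := (2 * S j)%nat.
Let chi_div (t : R) : R := even_series (fun n => / oddR n ^ s) t.

Let ex_series_s : ex_series (fun n => / oddR n ^ s).
Proof.
unfold s; replace (2 * S j)%nat with (S (S (2 * j))) by lia; apply ex_series_inv_oddR_pow.
Qed.

Lemma continuous_chi_div_clamp (t : R) : continuous (fun y => chi_div (clamp y)) t.
Proof.
unfold chi_div, even_series, PSeries.
apply (continuous_Series_dominated (fun n y => / oddR n ^ s * (clamp y ^ 2) ^ n)
         (fun n => / oddR n ^ s)); [| | exact ex_series_s].
- intros n y.
  apply (continuous_comp clamp (fun z => / oddR n ^ s * (z ^ 2) ^ n)); [apply continuous_clamp |].
  apply (ex_derive_continuous (fun z : R => / oddR n ^ s * (z ^ 2) ^ n)); auto_derive; trivial.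
- intros n y; destruct (clamp_bounds y); destruct (inv_oddR_pow_bounds s n).
  assert (0 <= (clamp y ^ 2) ^ n <= 1).
  { split; [apply pow_le; nra |]; rewrite <- (pow1 n); apply pow_incr; nra. }
  rewrite Rabs_pos_eq by nra; nra.
Qed.

Lemma chi_div_bounds (t : R) : 0 <= t <= 1 ->
  0 <= chi_div t <= Series (fun n => / oddR n ^ s).
Proof.
intros Ht; unfold chi_div, even_series, PSeries.
assert (Hterm : forall n, 0 <= / oddR n ^ s * (t ^ 2) ^ n <= / oddR n ^ s).
{ intros n; destruct (inv_oddR_pow_bounds s n).
  assert (0 <= (t ^ 2) ^ n <= 1); [| nra].
  split; [apply pow_le; nra |]; rewrite <- (pow1 n); apply pow_incr; nra. }
split; [| now apply Series_le].
rewrite <- (Rmult_0_l (Series (fun n => / oddR n ^ s))), <- Series_scal_l.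
apply Series_le.
- intros n; rewrite Rmult_0_l; split; [apply Rle_refl | apply Hterm].
- apply (ex_series_le (K := R_AbsRing) (V := R_CompleteNormedModule) _ _) with (2 := ex_series_s).
  intros n; unfold norm; simpl; unfold abs; simpl.
  change (Rabs (/ oddR n ^ s * (t ^ 2) ^ n) <= / oddR n ^ s).
  rewrite Rabs_pos_eq; apply Hterm.
Qed.

Lemma ln_half_angle (t : R) : 0 < t ->
  ln ((1 + t ^ 2) / (2 * t)) = - ln (half_angle_sin t).
Proof.
intros Ht; pose proof (one_plus_sqr_pos t); unfold half_angle_sin.
rewrite <- ln_Rinv by (apply Rdiv_lt_0_compat; lra).
f_equal; field; lra.
Qed.

Lemma integrand_eq (t : R) : 0 < t ->
  integrand (S j) (S K) t = (- ln (half_angle_sin t)) ^ K * chi_div t.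
Proof.
intros Ht; unfold integrand; rewrite ln_half_angle, legendre_chi_even_series by exact Ht.
replace (S K - 1)%nat with K by lia; fold s (chi_div t); unfold chi_div; field; lra.
Qed.

Lemma half_angle_sin_ge (t : R) : 0 < t <= 1 -> t <= half_angle_sin t <= 1.
Proof.
intros Ht; pose proof (one_plus_sqr_pos t); unfold half_angle_sin; split;
  (apply Rmult_le_reg_r with (1 + t ^ 2); [lra |]);
  unfold Rdiv; rewrite Rmult_assoc, Rinv_l by lra; nra.
Qed.

(** The factorial cancels the one in [log_weight], so that [integrand_bound * log_weight K t] is (-
    ln t)^K times the value of chi_s at 1. *)
Definition integrand_bound : R := INR (fact K) * Series (fun n => / oddR n ^ s).

(** Since t <= x <= 1, 0 <= - ln x <= - ln t; the factor chi_s (t) / t is largest at t = 1. *)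
Lemma integrand_bounds (t : R) : 0 < t <= 1 ->
  0 <= integrand (S j) (S K) t <= integrand_bound * log_weight K t.
Proof.
intros Ht; rewrite integrand_eq by lra.
pose proof (half_angle_sin_ge t Ht); pose proof (chi_div_bounds t ltac:(lra)).
pose proof (neg_ln_nonneg (half_angle_sin t) ltac:(lra)).
pose proof (ln_le t (half_angle_sin t) ltac:(lra) ltac:(lra)).
assert (Hpow : 0 <= (- ln (half_angle_sin t)) ^ K <= (- ln t) ^ K).
{ split; [apply pow_le; lra | apply pow_incr; lra]. }
unfold integrand_bound, log_weight; pose proof (INR_fact_neq_0 K).
replace (INR (fact K) * Series (fun n => / oddR n ^ s) * ((- ln t) ^ K / INR (fact K)))
  with ((- ln t) ^ K * Series (fun n => / oddR n ^ s)) by (field; assumption).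
split; [apply Rmult_le_pos; lra | apply Rmult_le_compat; lra].
Qed.

Lemma ex_RInt_integrand (a b : R) : 0 < a <= b -> b <= 1 ->
  ex_RInt (integrand (S j) (S K)) a b.
Proof.
intros Ha Hb.
(* Continuity is required on the closed interval, whose right end may be 1; inserting [clamp]
   secures it there without changing the values. *)
apply (ex_RInt_ext (V := R_CompleteNormedModule) (fun t => (- ln (half_angle_sin t)) ^ K * chi_div (clamp t))).
- intros t; rewrite Rmin_left, Rmax_right by lra; intros Ht.
  rewrite integrand_eq, clamp_id by lra; reflexivity.
- apply (ex_RInt_continuous (V := R_CompleteNormedModule)); intros t; rewrite Rmin_left, Rmax_right by lra; intros Ht.
  apply (continuous_mult (fun t => (- ln (half_angle_sin t)) ^ K) (fun t => chi_div (clamp t)));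
    [| apply continuous_chi_div_clamp].
  apply (ex_derive_continuous (fun t : R => (- ln (half_angle_sin t)) ^ K)).
  pose proof (half_angle_sin_ge t ltac:(lra)).
  auto_derive; repeat split; trivial; [| lra].
  eexists; apply is_derive_half_angle_sin.
Qed.

Lemma integrand_bound_nonneg : 0 <= integrand_bound.
Proof.
unfold integrand_bound; apply Rmult_le_pos; [apply pos_INR |].
destruct (chi_div_bounds 0); lra.
Qed.

Let J (a b : R) : R := RInt (integrand (S j) (S K)) a b.

Lemma RInt_integrand_Chasles (a b c : R) : 0 < a <= b -> b <= c <= 1 -> J a b + J b c = J a c.
Proof.
intros Hab Hbc; apply (RInt_Chasles (V := R_CompleteNormedModule)); apply ex_RInt_integrand; lra.
Qed.

Lemma RInt_integrand_nonneg (a b : R) : 0 < a <= b -> b <= 1 -> 0 <= J a b.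
Proof.
intros Hab Hb; apply RInt_ge_0; [lra | apply ex_RInt_integrand; lra |].
intros t Ht; apply integrand_bounds; lra.
Qed.

(** With upper limit 1, this makes the contribution of a short interval next to 1 small. *)
Lemma RInt_integrand_le_const (a b : R) : 0 < a <= b -> b <= 1 ->
  J a b <= (b - a) * (integrand_bound * log_weight K a).
Proof.
intros Hab Hb; rewrite <- (RInt_const a b (integrand_bound * log_weight K a) : _ = (b - a) * _).
apply RInt_le; [lra | apply ex_RInt_integrand; lra | apply ex_RInt_const |].
intros t Ht; eapply Rle_trans; [apply integrand_bounds; lra |].
apply Rmult_le_compat_l; [apply integrand_bound_nonneg | apply log_weight_antitone; lra].
Qed.

(** A bound uniform in [a]: the weight is integrated by its primitive for n = 0, which is 1 at 1 and
    nonnegative at [a]. *)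
Lemma RInt_integrand_le_bound (a : R) : 0 < a <= 1 -> J a 1 <= integrand_bound.
Proof.
intros Ha.
assert (Hw : is_RInt (fun t => integrand_bound * log_weight K t) a 1
   (integrand_bound * (log_primitive K 0 1 - log_primitive K 0 a))).
{ apply (is_RInt_scal (log_weight K)).
  apply (is_RInt_derive (log_primitive K 0));
    intros t; rewrite Rmin_left, Rmax_right by lra; intros Ht.
  - evar_last; [apply is_derive_log_primitive; lra |].
    unfold log_weight; simpl (2 * 0)%nat; rewrite pow_O; ring.
  - apply continuous_log_weight; lra. }
apply Rle_trans with (RInt (fun t => integrand_bound * log_weight K t) a 1).
- apply RInt_le; [lra | apply ex_RInt_integrand; lra | eexists; exact Hw |].
  intros t Ht; apply integrand_bounds; lra.
- rewrite (is_RInt_unique _ _ _ _ Hw), log_primitive_1.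
  replace (oddR 0) with 1 by (unfold oddR; simpl; ring); rewrite pow1, Rinv_1.
  pose proof (log_primitive_nonneg K 0 a Ha); pose proof integrand_bound_nonneg; nra.
Qed.

(** The integral over [a, 1] grows as [a] decreases and stays bounded, so it converges to its
    supremum. The supremum property is kept for both comparisons with the series. *)
Lemma is_RInt_gen_integrand : exists I,
  is_RInt_gen (integrand (S j) (S K)) (at_right 0) (at_point 1) I /\
  is_lub (fun y => exists a, 0 < a <= 1 /\ y = J a 1) I.
Proof.
destruct (completeness (fun y => exists a, 0 < a <= 1 /\ y = J a 1)) as [I HI].
- exists integrand_bound; intros y [a [Ha ->]]; now apply RInt_integrand_le_bound.
- exists (J 1 1), 1; split; [lra | reflexivity].
- exists I; split; [| exact HI]; intros P [eps HP].
  assert (Hex : exists a, 0 < a <= 1 /\ I - eps < J a 1).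
  { apply Classical_Prop.NNPP; intros Hn.
    assert (I <= I - eps); [| pose proof (cond_pos eps); lra].
    apply HI; intros y [a [Ha ->]]; apply Rnot_lt_le; intros Hlt.
    apply Hn; now exists a. }
  destruct Hex as [a [Ha Hlt]].
  (* For 0 < x < a, I - eps < J a 1 <= J x 1 <= I. *)
  apply (Filter_prod _ _ _ (fun x => 0 < x < a) (fun y => y = 1)).
  + exists (mkposreal a (proj1 Ha)); intros y Hy Hy0.
    unfold ball in Hy; simpl in Hy; unfold AbsRing_ball, abs, minus, plus, opp in Hy; simpl in Hy.
    apply Rabs_def2 in Hy; lra.
  + reflexivity.
  + intros x y Hx ->; exists (J x 1); split.
    * apply (RInt_correct (V := R_CompleteNormedModule)), ex_RInt_integrand; simpl; lra.
    * apply HP; unfold ball; simpl; unfold AbsRing_ball, abs, minus, plus, opp; simpl.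
      assert (J x 1 <= I) by (apply HI; exists x; split; [lra | reflexivity]).
      pose proof (RInt_integrand_Chasles x a 1 ltac:(lra) ltac:(lra)).
      pose proof (RInt_integrand_nonneg x a ltac:(lra) ltac:(lra)).
      apply Rabs_def1; pose proof (cond_pos eps); lra.
Qed.

Let g := outer_coeff (S j).

(** Termwise integration in x, followed by the substitution x = 2t / (1 + t^2);
    [even_series_half_angle] turns G_(j+1) (x) / x * dx/dt into 2 chi_s (t) / t. *)
Lemma is_series_RInt_integrand (a b : R) : 0 < a <= b -> b < 1 ->
  is_series (fun n => g n * (log_primitive K n (half_angle_sin b)
                             - log_primitive K n (half_angle_sin a)))
    (2 / INR (fact K) * J a b).
Proof.
intros Ha Hb.
pose proof (half_angle_sin_mono a b ltac:(lra) ltac:(lra)).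
pose proof (half_angle_sin_bounds a ltac:(lra)); pose proof (half_angle_sin_bounds b ltac:(lra)).
evar_last.
- apply is_series_integral; [intros n; apply outer_coeff_bounds
    | intros n; apply outer_coeff_abs_le | lra | lra].
- assert (Hcomp : is_RInt (fun t => half_angle_sin' t *
      (log_weight K (half_angle_sin t) * even_series g (half_angle_sin t))) a b
      (RInt (fun x => log_weight K x * even_series g x) (half_angle_sin a) (half_angle_sin b))).
  { apply (is_RInt_comp (V := R_CompleteNormedModule)
      (fun x => log_weight K x * even_series g x) half_angle_sin half_angle_sin').
    + intros t; rewrite Rmin_left, Rmax_right by lra; intros Ht.
      pose proof (half_angle_sin_bounds t ltac:(lra)).
      apply (continuous_mult (log_weight K) (even_series g)).
      * apply continuous_log_weight; lra.
      * apply continuous_even_series; [intros n; apply outer_coeff_abs_le | rewrite Rabs_pos_eq; lra].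
    + intros t _; split; [apply is_derive_half_angle_sin |].
      apply (ex_derive_continuous half_angle_sin'); unfold half_angle_sin'.
      pose proof (one_plus_sqr_pos t); auto_derive; apply Rgt_not_eq; simpl in *; nra. }
  rewrite <- (is_RInt_unique _ _ _ _ Hcomp).
  unfold J; rewrite <- (RInt_scal (V := R_CompleteNormedModule) (integrand (S j) (S K)))
      by (apply ex_RInt_integrand; lra).
    apply RInt_ext; intros t; rewrite Rmin_left, Rmax_right by lra; intros Ht.
    change (half_angle_sin' t * (log_weight K (half_angle_sin t) * even_series g (half_angle_sin t))
      = 2 / INR (fact K) * integrand (S j) (S K) t).
    rewrite integrand_eq by lra.
    replace (half_angle_sin' t * (log_weight K (half_angle_sin t) * even_series g (half_angle_sin t)))
      with (log_weight K (half_angle_sin t) * (half_angle_sin' t * even_series g (half_angle_sin t))) by ring.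
    unfold g; rewrite even_series_half_angle by lra; fold s (chi_div t).
    unfold log_weight, chi_div; field; apply INR_fact_neq_0.
Qed.

End Integrand.

(** * Comparison of the series with the improper integral *)

Lemma is_lim_seq_log_primitive_0 (K n : nat) (x : nat -> R) :
  (forall m, 0 < x m <= 1) -> is_lim_seq x 0 ->
  is_lim_seq (fun m => log_primitive K n (x m)) 0.
Proof.
intros Hx Hlim; destruct (log_primitive_le_sqrt K n) as [C HC].
apply (is_lim_seq_le_le (fun _ => 0) _ (fun m => C * sqrt (x m))).
- intros m; split; [now apply log_primitive_nonneg | now apply HC].
- apply is_lim_seq_const.
- replace 0 with (C * sqrt 0) by (rewrite sqrt_0; ring).
  apply (is_lim_seq_scal_l _ _ (Finite _)).
  apply is_lim_seq_continuous; [apply continuity_pt_sqrt, Rle_refl | exact Hlim].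
Qed.

Lemma is_lim_seq_log_primitive_1 (K n : nat) (x : nat -> R) :
  is_lim_seq x 1 -> is_lim_seq (fun m => log_primitive K n (x m)) (/ oddR n ^ S K).
Proof.
intros Hlim; rewrite <- log_primitive_1.
apply is_lim_seq_continuous; [| exact Hlim].
apply continuity_pt_filterlim, (ex_derive_continuous (log_primitive K n)).
eexists; apply is_derive_log_primitive; lra.
Qed.

Lemma is_lim_seq_half_angle_sin (x : nat -> R) (l : R) :
  is_lim_seq x l -> is_lim_seq (fun m => half_angle_sin (x m)) (half_angle_sin l).
Proof.
apply is_lim_seq_continuous, continuity_pt_filterlim.
apply (ex_derive_continuous half_angle_sin); eexists; apply is_derive_half_angle_sin.
Qed.

(** For fixed N, the partial sum over [t_m, 1 - t_m] is at most the full series, hence at most the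
    scaled integral; letting t_m tend to 0 turns each term into its moment. *)
Lemma sum_outer_coeff_le (j K N : nat) (I : R) :
  (forall a, 0 < a <= 1 -> RInt (integrand (S j) (S K)) a 1 <= I) ->
  sum_f_R0 (fun n => outer_coeff (S j) n / oddR n ^ S K) N <= 2 / INR (fact K) * I.
Proof.
intros HI.
assert (Hc : 0 < 2 / INR (fact K)) by (apply Rdiv_lt_0_compat; [lra | apply INR_fact_lt_0]).
(* The shift by 3 keeps t_m <= 1/3, so that t_m < 1 - t_m. *)
set (t := fun m => / (INR m + 3)).
assert (Ht : forall m, 0 < t m <= 1 / 3).
{ intros m; pose proof (pos_INR m); unfold t; split; [apply Rinv_0_lt_compat; lra |].
  unfold Rdiv; rewrite Rmult_1_l; apply Rinv_le_contravar; lra. }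
assert (Hlim : is_lim_seq t 0).
{ apply (is_lim_seq_inv _ p_infty); [| easy].
  apply (is_lim_seq_plus _ _ p_infty 3); [apply is_lim_seq_INR | apply is_lim_seq_const | easy]. }
assert (Hlim0 : is_lim_seq (fun m => half_angle_sin (t m)) 0)
  by (rewrite <- half_angle_sin_0; now apply is_lim_seq_half_angle_sin).
assert (Hlim1 : is_lim_seq (fun m => half_angle_sin (1 - t m)) 1).
{ evar_last; [apply (is_lim_seq_half_angle_sin _ (1 - 0)) |].
  - apply is_lim_seq_minus'; [apply is_lim_seq_const | exact Hlim].
  - now rewrite Rminus_0_r, half_angle_sin_1. }
assert (Hterm : forall n, is_lim_seq
   (fun m => outer_coeff (S j) n * (log_primitive K n (half_angle_sin (1 - t m))
                                    - log_primitive K n (half_angle_sin (t m))))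
   (outer_coeff (S j) n / oddR n ^ S K)).
{ intros n; unfold Rdiv; rewrite <- (Rminus_0_r (/ _)).
  apply (is_lim_seq_scal_l _ _ (Finite _)), is_lim_seq_minus'.
  - now apply is_lim_seq_log_primitive_1.
  - apply is_lim_seq_log_primitive_0; [| exact Hlim0].
    intros m; specialize (Ht m); pose proof (half_angle_sin_bounds (t m) ltac:(lra)); lra. }
set (v := fun m => sum_f_R0 (fun n => outer_coeff (S j) n *
   (log_primitive K n (half_angle_sin (1 - t m)) - log_primitive K n (half_angle_sin (t m)))) N).
apply (is_lim_seq_le v (fun _ => 2 / INR (fact K) * I) (Finite _) (Finite _)).
- intros m; specialize (Ht m).
  assert (Hs := is_series_RInt_integrand j K (t m) (1 - t m) ltac:(lra) ltac:(lra)).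
  apply Rle_trans with (2 / INR (fact K) * RInt (integrand (S j) (S K)) (t m) (1 - t m)).
  + unfold v; rewrite <- sum_n_Reals.
    apply (is_lim_seq_incr_compare _ _ Hs); intros n.
    rewrite !sum_n_Reals; cbn [sum_f_R0].
    match goal with |- ?a <= ?a + ?b => enough (0 <= b) by lra end.
    apply Rmult_le_pos; [apply outer_coeff_bounds |].
    pose proof (half_angle_sin_bounds (t m) ltac:(lra)).
    pose proof (half_angle_sin_bounds (1 - t m) ltac:(lra)).
    pose proof (half_angle_sin_mono (t m) (1 - t m) ltac:(lra) ltac:(lra)).
    pose proof (log_primitive_le K (S n) (half_angle_sin (t m)) (half_angle_sin (1 - t m))
      ltac:(lra) ltac:(lra)).
    lra.
  + apply Rmult_le_compat_l; [lra |].
    pose proof (RInt_integrand_Chasles j K (t m) (1 - t m) 1 ltac:(lra) ltac:(lra)).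
    pose proof (RInt_integrand_nonneg j K (1 - t m) 1 ltac:(lra) ltac:(lra)).
    specialize (HI (t m) ltac:(lra)); lra.
- unfold v; clear v; induction N as [|N IH]; cbn [sum_f_R0]; [apply Hterm |].
  apply is_lim_seq_plus'; [exact IH | apply Hterm].
- apply is_lim_seq_const.
Qed.

(** On [a, b] with b < 1, each term of the integrated series is at most its full moment, so the
    scaled integral is at most [l]; the remaining piece [b, 1] has an integral of order 1 - b. *)
Lemma RInt_integrand_le_series (j K : nat) (l a : R) :
  is_series (fun n => outer_coeff (S j) n / oddR n ^ S K) l -> 0 < a < 1 ->
  2 / INR (fact K) * RInt (integrand (S j) (S K)) a 1 <= l.
Proof.
intros Hl Ha.
set (c := 2 / INR (fact K)).
assert (Hc : 0 < c) by (apply Rdiv_lt_0_compat; [lra | apply INR_fact_lt_0]).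
(* The weight is taken at [a], where it dominates its value at every b > a, so [C] is independent of
   b. *)
set (C := integrand_bound j K * log_weight K a).
assert (HC : 0 <= C).
{ apply Rmult_le_pos; [apply integrand_bound_nonneg | apply log_weight_nonneg; lra]. }
assert (Hb : forall b, a < b < 1 -> c * RInt (integrand (S j) (S K)) a 1 <= l + (1 - b) * (c * C)).
{ intros b Hb.
  assert (Hs : c * RInt (integrand (S j) (S K)) a b <= l).
  { pose proof (is_series_RInt_integrand j K a b ltac:(lra) ltac:(lra)) as Hs; fold c in Hs.
    pose proof (half_angle_sin_bounds a ltac:(lra)).
    pose proof (half_angle_sin_bounds b ltac:(lra)).
    rewrite <- (is_series_unique _ _ Hs), <- (is_series_unique _ _ Hl).
    apply Series_le; [| eexists; exact Hl]; intros n.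
    pose proof (outer_coeff_bounds (S j) n).
    pose proof (half_angle_sin_mono a b ltac:(lra) ltac:(lra)).
    pose proof (log_primitive_le K n (half_angle_sin a) (half_angle_sin b)
      ltac:(lra) ltac:(lra)).
    pose proof (log_primitive_le K n (half_angle_sin b) 1 ltac:(lra) ltac:(lra)) as Hone.
    rewrite log_primitive_1 in Hone.
    pose proof (log_primitive_nonneg K n (half_angle_sin a) ltac:(lra)).
    split; [apply Rmult_le_pos; lra |].
    unfold Rdiv; apply Rmult_le_compat_l; lra. }
  pose proof (RInt_integrand_Chasles j K a b 1 ltac:(lra) ltac:(lra)).
  pose proof (RInt_integrand_le_const j K b 1 ltac:(lra) ltac:(lra)).
  assert (integrand_bound j K * log_weight K b <= C).
  { apply Rmult_le_compat_l; [apply integrand_bound_nonneg | apply log_weight_antitone; lra]. }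
  assert (RInt (integrand (S j) (S K)) b 1 <= (1 - b) * C) by nra.
  replace ((1 - b) * (c * C)) with (c * ((1 - b) * C)) by ring; nra. }
apply le_epsilon; intros eps Heps.
(* The first entry keeps 1 - d above [a]; the second makes the error d c C at most [eps], and the
   added 1 keeps its denominator positive. *)
set (d := Rmin ((1 - a) / 2) (eps / (c * C + 1))).
assert (HcC : 0 <= c * C) by nra.
assert (Hd : 0 < d) by (apply Rmin_pos; apply Rdiv_lt_0_compat; lra).
assert (Hd1 : d <= (1 - a) / 2) by apply Rmin_l.
assert (Hd2 : d * (c * C + 1) <= eps).
{ apply Rle_trans with (eps / (c * C + 1) * (c * C + 1)); [| right; field; lra].
  apply Rmult_le_compat_r; [lra | apply Rmin_r]. }
specialize (Hb (1 - d) ltac:(lra)).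
replace (1 - (1 - d)) with d in Hb by ring; nra.
Qed.

(** [RInt_gen] is total, so existence of the integral is asserted separately, whereas [is_series]
    carries both convergence and value. Only the endpoint 0 is improper. *)
Theorem theorem3p11 (j k : nat) (hj : (0 < j)%nat) (hk : (0 < k)%nat) :
  ex_RInt_gen (integrand j k) (at_right 0) (at_point 1) /\
  is_series (outer_term j k)
    (2 / INR (fact (k - 1)) * RInt_gen (integrand j k) (at_right 0) (at_point 1)).
Proof.
destruct j as [|j]; [lia |]; destruct k as [|K]; [lia |].
replace (S K - 1)%nat with K by lia.
destruct (is_RInt_gen_integrand j K) as [I [HI [Hub Hlub]]].
split; [now exists I |].
rewrite (is_RInt_gen_unique (V := R_CompleteNormedModule) _ _ HI).
apply (is_series_ext (fun n => outer_coeff (S j) n / oddR n ^ S K)).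
{ intros n; symmetry; apply outer_term_eq. }
assert (Hle : forall N, sum_n (fun n => outer_coeff (S j) n / oddR n ^ S K) N
                <= 2 / INR (fact K) * I).
{ intros N; rewrite sum_n_Reals; apply sum_outer_coeff_le.
  intros a Ha; apply Hub; now exists a. }
(* Nonnegative terms and bounded partial sums give a limit [l]; it remains to show that [l] is the
   scaled integral. *)
destruct (ex_finite_lim_seq_incr (sum_n (fun n => outer_coeff (S j) n / oddR n ^ S K))
            (2 / INR (fact K) * I)) as [l Hl]; [| exact Hle |].
{ intros n; rewrite !sum_n_Reals; cbn [sum_f_R0].
  match goal with |- ?a <= ?a + ?b => enough (0 <= b) by lra end.
  apply Rmult_le_pos; [apply outer_coeff_bounds | left; apply inv_oddR_pow_bounds]. }
replace (2 / INR (fact K) * I) with l; [exact Hl |].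
assert (Hc : 0 < 2 / INR (fact K)) by (apply Rdiv_lt_0_compat; [lra | apply INR_fact_lt_0]).
apply Rle_antisym.
- apply (is_lim_seq_le _ _ (Finite _) (Finite _) Hle Hl (is_lim_seq_const _)).
- apply Rmult_le_reg_l with (/ (2 / INR (fact K))); [now apply Rinv_0_lt_compat |].
  rewrite <- Rmult_assoc, Rinv_l, Rmult_1_l by lra.
  assert (Hinv : forall a, 0 < a < 1 ->
            RInt (integrand (S j) (S K)) a 1 <= / (2 / INR (fact K)) * l).
  { intros a Ha; apply Rmult_le_reg_l with (2 / INR (fact K)); [exact Hc |].
    rewrite <- (Rmult_assoc _ (/ _)), Rinv_r, Rmult_1_l by lra.
    now apply RInt_integrand_le_series. }
  (* As [I] is the least upper bound, it suffices to bound every integral over [a, 1]. At a = 1 the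
     integral is 0, which is at most the one over [1/2, 1]. *)
  apply Hlub; intros y [a [Ha ->]].
  destruct (Req_dec a 1) as [-> | Ha1]; [| apply Hinv; lra].
  eapply Rle_trans; [| apply (Hinv (1 / 2)); lra].
  rewrite RInt_point; apply RInt_integrand_nonneg; lra.
Qed.
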